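(* For all integers $m\ge k\ge 2$ and all positive integers $n$ with $2m-1>(k-1)n$, there exist a measurable space $(\Omega,\mathcal{F})$ and a mixture of measures $\mathcal{P}=\sum_{i=1}^m a_i\delta_{\mu_i}$ on it (with $m$ distinct components $\mu_1,\dots,\mu_m$, all weights $a_i>0$) such that $\mu_1,\dots,\mu_m$ are $k$-independent and $\mathcal{P}$ is not $n$-identifiable.
   Context: Given a measurable space $(\Omega,\mathcal{F})$, let $\mathcal{D}$ be the set of probability measures on $(\Omega,\mathcal{F})$, viewed as a subset of the real vector space of finite signed measures on $(\Omega,\mathcal{F})$, and equip $\mathcal{D}$ with its power-set $\sigma$-algebra. A mixture of measures is a probability measure on $\mathcal{D}$ of the form $\mathcal{P}=\sum_{i=1}^m a_i\delta_{\mu_i}$, where $m<\infty$, $\mu_i\in\mathcal{D}$, $a_i>0$, $\sum_{i=1}^m a_i=1$, and $\delta_{\mu}$ is the Dirac measure at $\mu$. Representations are always taken minimal, i.e. the $\mu_i$ are pairwise distinct; the $\mu_i$ are called the (mixture) components and $m$ is the number of components. Two mixtures of measures are equal when they are equal as measures on $\mathcal{D}$. For a positive integer $n$, define $V_n(\mathcal{P})=\sum_{i=1}^m a_i\mu_i^{\times n}$, a probability measure on $(\Omega^{n},\mathcal{F}^{\times n})$ (product $\sigma$-algebra), where $\mu_i^{\times n}$ is the $n$-fold product measure. A mixture of measures $\mathcal{P}$ with $m$ components is $n$-identifiable if there is no mixture of measures $\mathcal{P}'\ne\mathcal{P}$ on the same space with $m$ or fewer components such that $V_n(\mathcal{P}')=V_n(\mathcal{P})$.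 A sequence of vectors $x_1,\dots,x_m$ in a vector space is $k$-independent (where $k\le m$) if every subsequence consisting of $k$ of the vectors is linearly independent. *)

(* Defs.v *)
From HB Require Import structures.
From mathcomp Require Import all_boot all_order all_algebra.
From mathcomp Require Import all_classical all_reals all_analysis.

Set Implicit Arguments.
Unset Strict Implicit.
Unset Printing Implicit Defensive.

Import Order.TTheory GRing.Theory Num.Theory.
Import numFieldNormedType.Exports.

Local Open Scope classical_set_scope.
Local Open Scope ring_scope.

Section independence.
Context (R : pzRingType) (V : lmodType R).

Definition lin_indep n (x : 'I_n -> V) : Prop :=
  forall c : 'I_n -> R, \sum_(i < n) c i *: x i = 0 -> forall i, c i = 0.

(* Subsequences of length k are increasing selections s of indices. *)
Definition k_independent m (k : nat) (x : 'I_m -> V) : Prop :=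
  forall s : 'I_k -> 'I_m, {homo s : i j / (i < j)%N} -> lin_indep (x \o s).

End independence.

(* The measures and charges of the library are functions on all subsets of T,
   so two of them may denote the same measure on the sigma-algebra and still
   differ on non-measurable sets.  In the types [smeasure] and [pmeasure] below
   the values on non-measurable sets are fixed to be 0, so that Leibniz equality
   is equality of measures on the sigma-algebra. *)

Section finite_signed_measures.
Context d (T : measurableType d) (R : realType).

Definition smeasure_pred : {pred set T -> R^o} := fun nu =>
  `[< (exists mu : {charge set T -> \bar R},
         forall A, measurable A -> (nu A)%:E = mu A) /\
      (forall A, ~ measurable A -> nu A = 0) >].

Lemma smeasure_submod : submod_closed smeasure_pred.
Proof.
split=> [|a u v /asboolP[[mu muE] u0] /asboolP[[nu nuE] v0]]; apply/asboolP.
  by split=> //; exists czero.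
split=> [|A nA]; last first.
  by rewrite fctE [(a *: u) A](_ : _ = a *: u A)// u0// v0// scaler0 addr0.
exists (cadd (cscale a mu) nu) => A mA.
rewrite [RHS](_ : _ = a%:E * mu A + nu A)%E//.
by rewrite -muE// -nuE// -EFinM -EFinD.
Qed.

HB.instance Definition _ :=
  GRing.isSubmodClosed.Build R (set T -> R^o) smeasure_pred smeasure_submod.

Record smeasure := Smeasure {
  smeasure_val :> set T -> R^o;
  _ : smeasure_val \in smeasure_pred }.

HB.instance Definition _ := [isSub for smeasure_val].
HB.instance Definition _ := [Choice of smeasure by <:].
HB.instance Definition _ := [SubChoice_isSubLmodule of smeasure by <:].

End finite_signed_measures.

Lemma eq_probability d (T : measurableType d) (R : realType)
    (mu nu : probability T R) :
  mu = nu :> (set T -> \bar R) -> mu = nu.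
Proof.
case: mu nu => [m [[a1 a2] [a3] [a4] [a5] [a6] [a7] [a8]]].
case=> [n [[b1 b2] [b3] [b4] [b5] [b6] [b7] [b8]]] /= e.
case: _ / e b1 b2 b3 b4 b5 b6 b7 b8 => b1 b2 b3 b4 b5 b6 b7 b8.
have e1 := Prop_irrelevance a1 b1.
have e2 := Prop_irrelevance a2 b2.
subst a1 a2.
have e3 := Prop_irrelevance a3 b3.
have e4 := Prop_irrelevance a4 b4.
have e5 := Prop_irrelevance a5 b5.
have e6 := Prop_irrelevance a6 b6.
have e7 := Prop_irrelevance a7 b7.
have e8 := Prop_irrelevance a8 b8.
by subst.
Qed.

Section probability_measures.
Context d (T : measurableType d) (R : realType).

(* The set of all probability measures, with its power-set sigma-algebra
   (the isMeasurable instance below). *)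
Record pmeasure := Pmeasure {
  pmeasure_val :> probability T R;
  pmeasure_out : forall A, ~ measurable A -> pmeasure_val A = 0%E }.

HB.instance Definition _ := gen_eqMixin pmeasure.
HB.instance Definition _ := gen_choiceMixin pmeasure.

Section of_probability.
Variable mu : probability T R.

Definition mrestrict (A : set T) : \bar R :=
  if `[< measurable A >] then mu A else 0%E.

Lemma mrestrictE A : measurable A -> mrestrict A = mu A.
Proof. by move=> mA; rewrite /mrestrict asboolT. Qed.

Let mrestrict0 : mrestrict set0 = 0%E.
Proof. by rewrite mrestrictE. Qed.

Let mrestrict_ge0 A : (0 <= mrestrict A)%E.
Proof. by rewrite /mrestrict; case: ifP. Qed.

Let mrestrict_sigma_additive : semi_sigma_additive mrestrict.
Proof.
move=> F mF tF mUF; rewrite mrestrictE//.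
under eq_fun do under eq_bigr do rewrite mrestrictE//.
exact: measure_semi_sigma_additive.
Qed.

HB.instance Definition _ := isMeasure.Build _ _ _ mrestrict
  mrestrict0 mrestrict_ge0 mrestrict_sigma_additive.

Let mrestrict_setT : mrestrict setT = 1%E.
Proof. by rewrite mrestrictE// probability_setT. Qed.

HB.instance Definition _ :=
  Measure_isProbability.Build _ _ _ mrestrict mrestrict_setT.

Let mrestrict_out A : ~ measurable A -> mrestrict A = 0%E.
Proof. by move=> nA; rewrite /mrestrict asboolF. Qed.

Definition pmeasure_of : pmeasure := Pmeasure mrestrict_out.

End of_probability.

HB.instance Definition _ := isPointed.Build pmeasure (pmeasure_of point).

HB.instance Definition _ := @isMeasurable.Build default_measure_display
  pmeasure discrete_measurable discrete_measurable0
  discrete_measurableC discrete_measurableU.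

Lemma pmeasure_ext (mu nu : pmeasure) :
  (forall A, measurable A -> mu A = nu A) -> mu = nu.
Proof.
move=> eqmn.
have {}eqmn : mu = nu :> (set T -> \bar R).
  apply/funext => A; have [mA|nA] := pselect (measurable A); first exact: eqmn.
  by rewrite !pmeasure_out.
case: mu nu eqmn => mu mu0 [nu nu0] /= eqmn.
have eqp : mu = nu by exact: eq_probability.
case: _ / eqp nu0 => nu0; congr Pmeasure; exact: Prop_irrelevance.
Qed.

Let smeasure_ofP (mu : pmeasure) :
  (fun A => fine (mu A) : R^o) \in @smeasure_pred d T R.
Proof.
apply/asboolP; split=> [|A nA]; last by rewrite pmeasure_out.
exists (charge_of_finite_measure mu) => A mA.
by rewrite fineK// fin_num_measure.
Qed.

Definition smeasure_of (mu : pmeasure) : smeasure T R :=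
  Smeasure (smeasure_ofP mu).

End probability_measures.

Section product_power.
Context d (T : measurableType d) (R : realType) (mu : probability T R).

Definition tcons n (x : T * n.-tuple T) : n.+1.-tuple T := [tuple of x.1 :: x.2].

Let measurable_tcons n : measurable_fun [set: T * n.-tuple T] (@tcons n).
Proof. exact: measurable_cons. Qed.

HB.instance Definition _ n :=
  isMeasurableFun.Build _ _ _ _ (@tcons n) (@measurable_tcons n).

Fixpoint mpower (n : nat) : probability (n.-tuple T) R :=
  match n with
  | 0 => \d_([tuple] : 0.-tuple T)
  | n.+1 => distribution (mu \x mpower n)%E (@tcons n)
  end.

Lemma mpowerE n (A : 'I_n -> set T) : (forall i, measurable (A i)) ->
  mpower n [set t | forall i, A i (tnth t i)] = (\prod_(i < n) mu (A i))%E.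
Proof.
elim: n A => [|n IHn] A mA.
  by rewrite big_ord0/= diracE mem_set//= => -[].
rewrite big_ord_recl/= /distribution /pushforward.
rewrite [X in (_ \x _)%E X](_ : _ = A ord0 `*`
    [set t | forall i, A (lift ord0 i) (tnth t i)]); last first.
  apply/seteqP; split=> [[x t] /= At|[x t] /= [A0 At] i].
    by split=> [|i]; [exact: (At ord0)|have := At (lift ord0 i); rewrite tnthS].
  by have [j ->|->//] := unliftP ord0 i; rewrite tnthS.
rewrite product_measure1E//; first by congr (_ * _)%E; exact: IHn.
have -> : [set t : n.-tuple T | forall i, A (lift ord0 i) (tnth t i)] =
    \big[setI/setT]_(i < n) ((fun t => tnth t i) @^-1` A (lift ord0 i)).
  rewrite -bigcap_seq; apply/seteqP; split=> t /= At i; first by move=> _.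
  by apply: At; rewrite /= mem_index_enum.
apply: bigsetI_measurable => i _; rewrite -[X in measurable X]setTI.
exact: measurable_tnth.
Qed.

End product_power.

(* [mixture] is the data of a minimal representation
   \sum_(i < m) a_i \d_(mu_i), which [mixture_measure] determines only up to
   reindexing: equality of mixtures is equality of their [mixture_measure]s,
   not Leibniz equality of the records. *)
Record mixture d (T : measurableType d) (R : realType) := Mixture {
  ncomp : nat;
  weight : 'I_ncomp -> R;
  component : 'I_ncomp -> pmeasure T R;
  weight_gt0 : forall i, 0 < weight i;
  weight_sum1 : \sum_(i < ncomp) weight i = 1;
  component_inj : injective component }.

Arguments weight {d T R} m i : rename.
Arguments component {d T R} m i : rename.
Arguments weight_gt0 {d T R} m i : rename.

Section mixture_theory.
Context d (T : measurableType d) (R : realType) (P : mixture T R).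

Section average.
Context d' (U : measurableType d') (nu : 'I_(ncomp P) -> probability U R).

Definition average (A : set U) : \bar R :=
  (\sum_(i < ncomp P) (weight P i)%:E * nu i A)%E.

Let average0 : average set0 = 0%E.
Proof. by rewrite /average big1// => i _; rewrite measure0 mule0. Qed.

Let average_ge0 A : (0 <= average A)%E.
Proof.
by apply: sume_ge0 => i _; rewrite mule_ge0// lee_fin ltW// weight_gt0.
Qed.

Let average_sigma_additive : semi_sigma_additive average.
Proof.
move=> F mF tF mUF; rewrite [X in _ --> X](_ : _ =
    lim ((fun n => \sum_(0 <= i < n) average (F i))%E @ \oo)).
  by apply: is_cvg_ereal_nneg_natsum => k _; exact: average_ge0.
rewrite nneseries_sum//; last first.
  by move=> i j _; rewrite mule_ge0// lee_fin ltW// weight_gt0.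
apply: eq_bigr => /= i _; rewrite nneseriesZl//.
by rewrite measure_semi_bigcup.
Qed.

HB.instance Definition _ := isMeasure.Build _ _ _ average
  average0 average_ge0 average_sigma_additive.

Let average_setT : average setT = 1%E.
Proof.
rewrite /average; under eq_bigr do rewrite probability_setT mule1.
by rewrite sumEFin weight_sum1.
Qed.

HB.instance Definition _ :=
  Measure_isProbability.Build _ _ _ average average_setT.

End average.

Definition mixture_measure : probability (pmeasure T R) R :=
  average (fun i => \d_(component P i)).

Definition V (n : nat) : probability (n.-tuple T) R :=
  average (fun i => mpower (component P i) n).

End mixture_theory.

Definition identifiable d (T : measurableType d) (R : realType) (n : nat)
    (P : mixture T R) : Prop :=
  ~ exists P' : mixture T R,
    [/\ (ncomp P' <= ncomp P)%N,
        ~ (forall S : set (pmeasure T R),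
             mixture_measure P' S = mixture_measure P S) &
        forall A : set (n.-tuple T), measurable A -> V P' n A = V P n A].

(* Main.v *)
(* The mixed measures are binomial laws of order k - 1 on nat.  Any k distinct
   ones are independent, by a Vandermonde determinant, whereas the n-th product
   power of the law of parameter t gives every event a probability that is
   polynomial in t, of degree at most (k - 1) n <= 2 m - 2.  The finite
   difference of order 2 m - 1 over 2 m equally spaced parameters kills such
   polynomials; its coefficients (-1)^j 'C(2 m - 1, j) have alternating signs,
   so the even-indexed and the odd-indexed parameters give two mixtures of m
   components with the same n-th power. *)
Require Import Defs.
From HB Require Import structures.
From mathcomp Require Import all_boot all_order all_algebra.
From mathcomp Require Import all_classical all_reals all_analysis.
From mathcomp Require Import zify ring lra.

Import Order.TTheory GRing.Theory Num.Theory.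

(** * Finite differences of polynomials *)

Section finite_differences.
Local Open Scope ring_scope.

Lemma sum_ord_double (V : nmodType) (m : nat) (F : nat -> V) :
  \sum_(j < m.*2) F j = \sum_(i < m) F i.*2 + \sum_(i < m) F i.*2.+1.
Proof.
elim: m => [|m IHm]; first by rewrite !big_ord0 addr0.
by rewrite doubleS !big_ord_recr/= IHm -addrA addrACA.
Qed.

(** Induction on the order: by Pascal's rule, the difference of order [N.+1] of p is, up to sign,
    the one of order [N] of x |-> p(x + h) - p(x), whose degree is smaller. *)
Lemma alternating_binomial_sum0 (R : comNzRingType) (h : R) (N : nat)
    (p : {poly R}) : (size p <= N)%N ->
  \sum_(i < N.+1) (-1) ^+ i * 'C(N, i)%:R * p.[i%:R * h] = 0.
Proof.
elim: N p => [|N IHN] p sp.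
  move: sp; rewrite leqn0 size_poly_eq0 => /eqP ->.
  by rewrite big1// => i _; rewrite horner0 mulr0.
(* The Taylor expansion of p(x + h) - p(x): each normalised derivative has order at least 1, which
   makes the drop in size visible. *)
pose q := \sum_(i < N) h ^+ i.+1 *: p^`N(i.+1).
have qE x : p.[x + h] = p.[x] + q.[x].
  rewrite (nderiv_taylor_wide (mulrC x h) sp).
  rewrite big_ord_recl/= nderivn0 expr0 mulr1 horner_sum; congr (_ + _).
  by apply: eq_bigr => i _; rewrite hornerZ mulrC.
have /IHN q0 : (size q <= N)%N.
  apply: (leq_trans (size_sum _ _ _)); apply/bigmax_leqP => i _.
  apply: (leq_trans (size_scale_leq _ _)); apply/leq_sizeP => j Nj.
  rewrite coef_nderivn nth_default ?mul0rn// (leq_trans sp)// addSn ltnS.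
  by rewrite (leq_trans Nj)// leq_addl.
pose F (M : nat) i := (-1) ^+ i * 'C(M, i)%:R * p.[i%:R * h].
(* The added term is 0 because 'C(N, N.+1) = 0; both sums of Pascal's rule can then be split at
   index 0. *)
have FN : \sum_(i < N.+1) F N i = \sum_(i < N.+2) F N i.
  by rewrite [RHS]big_ord_recr/= [F N N.+1]/F bin_small// mulr0 mul0r addr0.
transitivity (- \sum_(i < N.+1) (-1) ^+ i * 'C(N, i)%:R * q.[i%:R * h]);
  last by rewrite q0 oppr0.
rewrite -[LHS]/(\sum_(i < N.+2) F N.+1 i) big_ord_recl.
have -> : F N.+1 (ord0 : 'I_N.+2) = F N (ord0 : 'I_N.+2) by rewrite /F !bin0.
have -> : \sum_(i < N.+1) F N.+1 (lift ord0 i) =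
  \sum_(i < N.+1) F N (lift ord0 i) -
  \sum_(i < N.+1) (-1) ^+ i * 'C(N, i)%:R * p.[i%:R * h + h].
  rewrite -sumrB; apply: eq_bigr => i _.
  rewrite /F lift0 binS natrD exprS -natr1 mulrDl mul1r.
  by rewrite mulrDr mulrDl !mulN1r !mulNr.
rewrite addrA -(big_ord_recl _ (fun i : 'I_N.+2 => F N i)) -FN.
rewrite -sumrB -sumrN; apply: eq_bigr => i _.
by rewrite qE /F -mulrBr opprD addrA subrr sub0r mulrN.
Qed.

End finite_differences.

(** * Product powers of binomial laws are polynomial in the parameter *)

Section binomial_powers.
Local Open Scope ring_scope.
Local Open Scope classical_set_scope.
Context {R : realType}.
Implicit Types (q n : nat) (t : R).

Definition binomial_pmeasure q t : pmeasure nat R :=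
  pmeasure_of (binomial_prob q t).

Definition bernstein_poly q j : {poly R} :=
  'X^j * (1 - 'X) ^+ (q - j) *+ 'C(q, j).

Lemma horner_bernstein_poly q j t :
  (bernstein_poly q j).[t] = binomial_pmf q t j.
Proof. by rewrite hornerMn hornerM hornerXn horner_exp !hornerE. Qed.

Lemma size_bernstein_poly q j : (j < q.+1)%N ->
  (size (bernstein_poly q j) <= q.+1)%N.
Proof.
move=> jq; rewrite /bernstein_poly -scaler_nat.
rewrite (leq_trans (size_scale_leq _ _))//.
have s1X : size (1 - 'X : {poly R})%R = 2%N.
  by rewrite -opprB size_polyN size_XsubC.
have := size_poly_exp_leq (1 - 'X : {poly R}) (q - j); rewrite s1X mul1n => sX.
apply: (leq_trans (size_polyMleq _ _)); rewrite size_polyXn.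
by move: sX; set s := size _; lia.
Qed.

Lemma integral_binomial_pmeasure q t (f : nat -> \bar R) :
  0 <= t <= 1 -> (forall x, 0 <= f x)%E ->
  (\int[binomial_pmeasure q t]_x f x =
   \sum_(j < q.+1) (binomial_pmf q t j)%:E * f j)%E.
Proof.
move=> /andP[t0 t1] f0.
rewrite (eq_measure_integral (binomial_prob q t)); last first.
  by move=> A mA _; rewrite /= mrestrictE.
exact: (@integral_binomial R q t t0 t1).
Qed.

Lemma binomial_pmeasure1 q t j : 0 <= t <= 1 ->
  binomial_pmeasure q t [set j] = (binomial_pmf q t j)%:E.
Proof.
move=> t01; rewrite /= mrestrictE///= /binomial_prob t01 esum_set1//.
by rewrite lee_fin binomial_pmf_ge0.
Qed.

(** Integrating over the first coordinate gives a finite sum over j <= q of a Bernstein polynomial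
    times the measure of the section at j, so each factor of the power adds at most q to the
    degree. *)
Lemma mpower_binomial_poly q n (A : set (n.-tuple nat)) : measurable A ->
  exists2 p : {poly R}, (size p <= (q * n).+1)%N &
    forall t, 0 <= t <= 1 ->
      mpower (binomial_pmeasure q t) n A = (p.[t])%:E.
Proof.
elim: n A => [|n IHn] A mA.
  (* The power of order 0 is the Dirac mass at the empty tuple, whatever t. *)
  exists (\1_A [tuple])%:P => [|t t01].
    by rewrite muln0 size_polyC_leq1.
  by rewrite hornerC /= diracE.
pose B := @tcons _ nat n @^-1` A.
have mB : measurable B.
  by rewrite -[B]setTI; apply: (measurable_funPT (@tcons _ nat n)).
have /choice[p pP] : forall j : nat, exists p : {poly R},
    (size p <= (q * n).+1)%N /\ forall t, 0 <= t <= 1 ->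
      mpower (binomial_pmeasure q t) n (xsection B j) = (p.[t])%:E.
  move=> j; have [p sp pE] := IHn _ (measurable_xsection j mB).
  by exists p.
exists (\sum_(j < q.+1) bernstein_poly q j * p j).
  apply: (leq_trans (size_sum _ _ _)); apply/bigmax_leqP => j _.
  apply: (leq_trans (size_polyMleq _ _)).
  have [spj _] := pP j.
  have := size_bernstein_poly q j (ltn_ord j).
  rewrite mulnS; lia.
move=> t t01.
rewrite /= /distribution /pushforward /product_measure1.
rewrite (integral_binomial_pmeasure _ _ _ t01)//.
rewrite horner_sum -sumEFin; apply: eq_bigr => j _.
have [_ /(_ _ t01)/= pE] := pP j.
rewrite -[X in (_ * X)%E]/(mpower _ n (xsection B j)) pE -EFinM.
by rewrite hornerM horner_bernstein_poly.
Qed.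

End binomial_powers.

(** * Independence of binomial laws *)

Section binomial_independence.
Local Open Scope ring_scope.
Local Open Scope classical_set_scope.
Context {R : realType}.
Implicit Type q : nat.

(** The mass at 0 is (1 - t)^q, which determines t in [0, 1]. *)
Lemma binomial_pmeasure_inj q : (0 < q)%N ->
  {in [pred t : R | 0 <= t <= 1] &, injective (binomial_pmeasure q)}.
Proof.
move=> q0 t u t01 u01 tu.
have := congr1 (fun nu : pmeasure nat R => nu [set 0%N]) tu.
rewrite !binomial_pmeasure1// => -[].
rewrite /binomial_pmf !expr0 !mul1r subn0 bin0 !mulr1n => /eqP.
move: t01 u01; rewrite !inE => /andP[t0 t1] /andP[u0 u1].
rewrite eqrXn2 ?subr_ge0// => /eqP.
exact: (@subrI _ 1).
Qed.

Lemma smeasure_sumE m (c : 'I_m -> R) (nu : 'I_m -> smeasure nat R) A :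
  (\sum_(i < m) c i *: nu i : smeasure nat R) A = \sum_(i < m) c i * nu i A.
Proof.
rewrite -[LHS]/(\val (\sum_(i < m) c i *: nu i) A) raddf_sum fct_sumE.
exact: eq_bigr.
Qed.

(* Up to nonzero factors, the value at j of the binomial law of parameter t is
   the j-th power of the odds t / (1 - t), whence a Vandermonde system. *)
Lemma binomial_lin_indep q (t : 'I_q.+1 -> R) :
  injective t -> (forall i, 0 <= t i < 1) ->
  lin_indep (fun i => smeasure_of (binomial_pmeasure q (t i))).
Proof.
move=> tI t01 c c0.
have t1 i : 1 - t i != 0.
  by have /andP[_ ti1] := t01 i; rewrite subr_eq0 eq_sym lt_eqF.
pose u := \row_i (t i / (1 - t i)).
pose v := \col_i (c i * (1 - t i) ^+ q).
have Vu : Vandermonde q.+1 u \in unitmx.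
  rewrite unitmxE det_Vandermonde unitfE.
  apply/prodf_neq0 => i _; apply/prodf_neq0 => j ij.
  rewrite !mxE subr_eq0 eqr_div//; apply: contraTN ij => /eqP e.
  have -> : i = j by apply: tI; lra.
  by rewrite ltnn.
(* Row j is the vanishing combination evaluated at {j} and divided by 'C(q, j), since t^j (1 - t)^(q
   - j) = (1 - t)^q (t / (1 - t))^j. *)
have Vv : Vandermonde q.+1 u *m v = 0.
  apply/colP => j; rewrite !mxE.
  have Cj : 'C(q, j)%:R != 0 :> R by rewrite pnatr_eq0 -lt0n bin_gt0 -ltnS.
  apply: (mulfI Cj); rewrite mulr0.
  have := congr1 (fun nu : smeasure nat R => nu [set val j]) c0.
  rewrite smeasure_sumE [RHS](_ : _ = 0)// => c0j.
  rewrite -[RHS]c0j mulr_sumr; apply: eq_bigr => i _.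
  rewrite !mxE [X in _ = _ * X]/=.
  rewrite -[X in _ = _ * fine X]/(binomial_pmeasure q (t i) [set val j]).
  rewrite binomial_pmeasure1; last by have /andP[-> /ltW] := t01 i.
  rewrite /= /binomial_pmf -mulr_natl expr_div_n.
  rewrite -[in (1 - t i) ^+ q](subnKC (ltn_ord j : (j <= q)%N)) exprD.
  have : (1 - t i) ^+ j != 0 by rewrite expf_neq0.
  by rewrite /unstable.onem; move: ((1 - t i) ^+ j) => X X0; field.
move=> i; have : v = 0 by rewrite -[v](mulKmx Vu) Vv mulmx0.
move=> /colP/(_ i); rewrite !mxE => /eqP.
by rewrite mulf_eq0 expf_eq0 (negPf (t1 i)) andbF orbF => /eqP.
Qed.

End binomial_independence.

(** * The even-indexed and odd-indexed mixtures *)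

Section alternating_mixtures.
Local Open Scope ring_scope.
Local Open Scope classical_set_scope.
Context {R : realType}.
Variables (q m : nat).

(** In this section [m.+1] is the number of components and [q.+2] the order of independence. The
    nodes used stay below 1, so that their odds are finite. *)
Definition node j : R := j%:R * m.+1.*2%:R^-1.

Lemma node_itv j : (j < m.+1.*2)%N -> 0 <= node j < 1.
Proof.
move=> jm; rewrite mulr_ge0 ?invr_ge0//=.
by rewrite ltr_pdivrMr ?ltr0n// mul1r ltr_nat.
Qed.

Lemma node_inj : injective node.
Proof.
move=> i j /mulIf; rewrite invr_eq0 pnatr_eq0 => /(_ isT) /eqP.
by rewrite eqr_nat => /eqP.
Qed.

(** [b] is coerced to 0 or 1: [true] selects the odd indices, [false] the even ones. *)
Definition parity_node (b : bool) (i : 'I_m.+1) : R := node (b + i.*2).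

Lemma parity_node_itv b i : 0 <= parity_node b i < 1.
Proof. by apply: node_itv; case: i b => i /= im []; lia. Qed.

Lemma parity_node01 b i : 0 <= parity_node b i <= 1.
Proof. by have /andP[-> /ltW] := parity_node_itv b i. Qed.

Lemma parity_node_eq b b' i i' :
  parity_node b i = parity_node b' i' -> b = b' /\ i = i'.
Proof.
move=> /node_inj e; have : b = b' by case: b b' e => -[]; lia.
by move=> bb'; split=> //; apply: val_inj; move: e; rewrite bb' /=; lia.
Qed.

Definition parity_bin (b : bool) (i : 'I_m.+1) : R := 'C(m.*2.+1, b + i.*2)%:R.

Lemma parity_bin_gt0 b i : 0 < parity_bin b i.
Proof. by rewrite ltr0n bin_gt0; case: i b => i /= im []; lia. Qed.

(** The difference of order 2m + 1 vanishes on p; its odd-indexed terms, the negative ones, are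
    moved to the other side. *)
Lemma parity_bin_sum (p : {poly R}) : (size p <= m.*2.+1)%N ->
  \sum_(i < m.+1) parity_bin true i * p.[parity_node true i] =
  \sum_(i < m.+1) parity_bin false i * p.[parity_node false i].
Proof.
move=> sp; have := @alternating_binomial_sum0 R m.+1.*2%:R^-1 _ _ sp.
pose F j := (-1) ^+ j * 'C(m.*2.+1, j)%:R * p.[node j].
rewrite -[X in X = _]/(\sum_(j < m.+1.*2) F j) sum_ord_double => /eqP.
rewrite addr_eq0 => /eqP sE.
transitivity (- \sum_(i < m.+1) F i.*2.+1).
  rewrite -sumrN; apply: eq_bigr => i _.
  rewrite /F exprS -mul2n exprM sqrrN expr1n expr1n mulr1 -mulrA mulN1r opprK.
  by rewrite mul2n.
rewrite -sE; apply: eq_bigr => i _.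
by rewrite /F -mul2n exprM sqrrN expr1n expr1n mul1r mul2n.
Qed.

Definition parity_mass : R := \sum_(i < m.+1) parity_bin false i.

Lemma parity_mass_gt0 : 0 < parity_mass.
Proof.
rewrite /parity_mass big_ord_recl ltr_pwDl ?parity_bin_gt0//.
by apply: sumr_ge0 => i _; rewrite ltW// parity_bin_gt0.
Qed.

Lemma parity_massE b : \sum_(i < m.+1) parity_bin b i = parity_mass.
Proof.
(* The constant polynomial 1 equates the two totals. *)
case: b => //; have := @parity_bin_sum 1.
rewrite size_poly1 => /(_ isT).
under eq_bigr do rewrite hornerC mulr1.
by under [RHS]eq_bigr do rewrite hornerC mulr1.
Qed.

Definition parity_weight b i : R := parity_bin b i / parity_mass.

Lemma parity_weight_gt0 b i : 0 < parity_weight b i.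
Proof. by rewrite divr_gt0 ?parity_bin_gt0 ?parity_mass_gt0. Qed.

Lemma parity_weight_sum1 b : \sum_(i < m.+1) parity_weight b i = 1.
Proof. by rewrite -mulr_suml parity_massE divff// gt_eqF// parity_mass_gt0. Qed.

Definition parity_component b i : pmeasure nat R :=
  binomial_pmeasure q.+1 (parity_node b i).

Lemma parity_component_eq b b' i i' :
  parity_component b i = parity_component b' i' -> b = b' /\ i = i'.
Proof.
move=> e; apply: parity_node_eq; apply: (@binomial_pmeasure_inj R q.+1) e => //;
  by rewrite inE parity_node01.
Qed.

Lemma parity_component_inj b : injective (parity_component b).
Proof. by move=> i j /parity_component_eq[]. Qed.

Definition parity_mixture b : mixture nat R :=
  Mixture (@parity_weight_gt0 b) (parity_weight_sum1 b)
    (@parity_component_inj b).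

(** An increasing selection is injective, so it picks [q.+2] distinct parameters for laws of order
    [q.+1]. *)
Lemma parity_component_indep b :
  k_independent q.+2 (fun i => smeasure_of (component (parity_mixture b) i)).
Proof.
move=> s sh.
apply: (@binomial_lin_indep R q.+1 (fun i => parity_node b (s i))).
  move=> i j /parity_node_eq[_ ss]; apply: val_inj.
  by case: (ltngtP i j) => // /sh; rewrite ss ltnn.
by move=> i; exact: parity_node_itv.
Qed.

Lemma parity_mixture_neq :
  ~ forall S, mixture_measure (parity_mixture true) S =
              mixture_measure (parity_mixture false) S.
Proof.
(* An even-indexed component is an atom of one mixture and has mass 0 in the other. *)
move=> /(_ [set parity_component false ord0]) /=; rewrite /average /=.
rewrite big1 => [|i _]; last first.
  by rewrite diracE memNset ?mule0//= => /parity_component_eq[].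
rewrite big_ord_recl diracE mem_set//= mule1 => /esym/eqP.
rewrite gt_eqF// (lt_le_trans _ (leeDl _ _))// ?lte_fin ?parity_weight_gt0//.
by apply: sume_ge0 => i _; rewrite mule_ge0// lee_fin ltW// parity_weight_gt0.
Qed.

Lemma V_parity_mixture n (A : set (n.-tuple nat)) :
  (q.+1 * n <= m.*2)%N -> measurable A ->
  V (parity_mixture true) n A = V (parity_mixture false) n A.
Proof.
move=> qn mA; have [p sp pE] := @mpower_binomial_poly R q.+1 n A mA.
have VE b : V (parity_mixture b) n A =
    ((\sum_(i < m.+1) parity_bin b i * p.[parity_node b i]) / parity_mass)%:E.
  rewrite mulr_suml -sumEFin; apply: eq_bigr => i _ /=.
  rewrite [X in (_ * X)%E]pE ?parity_node01//.
  by rewrite -EFinM mulrAC.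
by rewrite !VE parity_bin_sum// (leq_trans sp).
Qed.

End alternating_mixtures.

Theorem theorem4p3 (R : realType) (m k n : nat) :
  (2 <= k)%N -> (k <= m)%N -> (0 < n)%N -> ((k - 1) * n < 2 * m - 1)%N ->
  exists (d : measure_display) (T : measurableType d) (P : mixture T R),
    [/\ ncomp P = m,
        k_independent k (fun i => smeasure_of (component P i)) &
        ~ identifiable n P].
Proof.
(* With k = q + 2 and m + 1 components, the hypothesis reads (q + 1) n <= 2m, the degree bound for
   the difference of order 2m + 1. *)
case: k => [|[|q]]// _; case: m => // m _ _; rewrite subn1 => qnm.
exists default_measure_display, nat, (parity_mixture q m false).
split=> //; first exact: parity_component_indep.
apply; exists (parity_mixture q m true).
split=> //; first exact: parity_mixture_neq.
by move=> A mA; apply: V_parity_mixture => //; move: qnm => /=; lia.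
Qed.
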